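(* Let $d\ge1$ be an integer, $m\ge1$ and $\beta>0$ real, $1\le p<\infty$, and let $Y$ be a complex Banach space. For a function $f$ on $\mathbb{C}^d$ and $0<r<1$, let $f_r(\zeta)=f(r\zeta)$. (a) If $f$ is in $F^{p}_{m,\beta}(Y)$, then $\|f-f_r\|_{F^{p}_{m,\beta}(Y)}$ tends to $0$ as $r\to1^-$. (b) If $f$ is in $F^{\infty,0}_{m,\beta}(Y)$, then $\|f-f_r\|_{F^{\infty}_{m,\beta}(Y)}$ tends to $0$ as $r\to1^-$.
   Context: $F^p_{m,\beta}(Y)$ is the space of $Y$-valued entire functions $f$ on $\mathbb{C}^d$ with $\|f\|^p_{F^p_{m,\beta}(Y)}=c_{m,\beta}\int_{\mathbb{C}^d}\|f(\zeta)e^{-\frac{\beta}{2}|\zeta|^{2m}}\|_Y^p\,dv(\zeta)<\infty$ if $1\le p<\infty$, and $\|f\|_{F^\infty_{m,\beta}(Y)}=\sup_{\zeta}\|f(\zeta)\|_Ye^{-\frac{\beta}{2}|\zeta|^{2m}}<\infty$ if $p=\infty$, where $dv$ is Lebesgue measure on $\mathbb{C}^d$ and $c_{m,\beta}=\frac{m\beta^{d/m}}{\pi^d}\frac{\Gamma(d)}{\Gamma(d/m)}$. $F^{\infty,0}_{m,\beta}(Y)$ is the space of $Y$-valued entire functions $f$ with $\lim_{|\zeta|\to\infty}\|f(\zeta)\|_Ye^{-\frac{\beta}{2}|\zeta|^{2m}}=0$. *)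

(* Defs.v *)
From HB Require Import structures.
From mathcomp Require Import all_boot all_order all_algebra.
From mathcomp Require Import complex.
From mathcomp Require Import all_classical all_reals all_analysis.

Set Implicit Arguments.
Unset Strict Implicit.
Unset Printing Implicit Defensive.

Import Order.TTheory GRing.Theory Num.Theory.
Import numFieldNormedType.Exports.

Local Open Scope classical_set_scope.
Local Open Scope ring_scope.

Section iterated_product_measure.
Context d (T : measurableType d) (R : realType).

Definition tuple_cons n (x : T * n.-tuple T) : n.+1.-tuple T :=
  [tuple of x.1 :: x.2].

Lemma measurable_tuple_cons n :
  measurable_fun [set: T * n.-tuple T] (@tuple_cons n).
Proof. exact: measurable_cons. Qed.

Section cons_measure.
Variables (mu : {sigma_finite_measure set T -> \bar R}) (n : nat).
Variable nu : {sigma_finite_measure set (n.-tuple T) -> \bar R}.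

Definition cons_measure : set (n.+1.-tuple T) -> \bar R :=
  pushforward (mu \x nu)%E (@tuple_cons n).

Let cons_measure0 : cons_measure set0 = 0%E.
Proof. by rewrite /cons_measure /pushforward preimage_set0 measure0. Qed.

Let cons_measure_ge0 A : (0 <= cons_measure A)%E.
Proof. by rewrite /cons_measure /pushforward; exact: measure_ge0. Qed.

Let cons_measure_sigma_additive : semi_sigma_additive cons_measure.
Proof.
move=> F mF tF mUF; rewrite /cons_measure /pushforward preimage_bigcup.
have mc (A : set (n.+1.-tuple T)) : measurable A ->
    measurable (@tuple_cons n @^-1` A).
  move=> mA; rewrite -[X in measurable X]setTI.
  exact: (measurable_tuple_cons measurableT).
apply: measure_semi_sigma_additive.
- by move=> k; exact: mc.
- apply/trivIsetP => /= i j _ _ ij; rewrite -preimage_setI.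
  by move/trivIsetP : tF => /(_ _ _ _ _ ij) ->//; rewrite preimage_set0.
- by rewrite -preimage_bigcup; exact: mc.
Qed.

HB.instance Definition _ := isMeasure.Build _ _ _ cons_measure
  cons_measure0 cons_measure_ge0 cons_measure_sigma_additive.

Let cons_measure_sigma_finite : sigma_finite setT cons_measure.
Proof.
have /sigma_finiteP[F [TF ndF Foo]] := sigma_finiteT mu.
have /sigma_finiteP[G [TG ndG Goo]] := sigma_finiteT nu.
pose H k := [set t : n.+1.-tuple T | F k (thead t) /\ G k [tuple of behead t]].
exists H.
  apply/esym/seteqP; split => // t _.
  have [k _ Fk] : (\bigcup_k F k) (thead t) by rewrite -TF.
  have [l _ Gl] : (\bigcup_k G k) [tuple of behead t] by rewrite -TG.
  exists (maxn k l) => //; split.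
    by move: (thead t) Fk; exact/subsetPset/ndF/leq_maxl.
  by move: [tuple of behead t] Gl; exact/subsetPset/ndG/leq_maxr.
move=> k; have [mF Fk] := Foo k; have [mG Gk] := Goo k; split.
  apply: measurableI; rewrite -[X in measurable X]setTI.
    exact: (@measurable_tnth _ T n.+1 ord0).
  exact: (@measurable_behead _ T n).
rewrite /cons_measure /pushforward.
have -> : @tuple_cons n @^-1` H k = F k `*` G k.
  apply/funext => -[x t].
  have bK : [tuple of behead (tuple_cons (x, t))] = t by exact/val_inj.
  by rewrite /preimage /H /= bK.
by rewrite product_measure1E// lte_mul_pinfty// ge0_fin_numE.
Qed.

HB.instance Definition _ := Measure_isSigmaFinite.Build _ _ _ cons_measure
  cons_measure_sigma_finite.

End cons_measure.

(* the n-fold product measure mu \x ... \x mu on n-tuples *)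
Fixpoint iter_measure (mu : {sigma_finite_measure set T -> \bar R}) n :
    {sigma_finite_measure set (n.-tuple T) -> \bar R} :=
  match n with
  | 0 => \d_ ([tuple] : 0.-tuple T)
  | n'.+1 => cons_measure mu (iter_measure mu n')
  end.

End iterated_product_measure.

Section fock_space.
Variable R : realType.

(* Identification of R^(d + d) with C^d, real parts first. Integrals over C^d
   are taken with respect to Lebesgue measure on R^(d + d) through it. *)
Definition complex_vector d (t : (d + d).-tuple R) : 'rV[R[i]]_d :=
  \row_j (tnth t (lshift d j) +i* tnth t (rshift d j))%C.

(* The Euclidean norm; the norm of 'rV[R[i]]_d as a normed module is the
   sup norm. *)
Definition cvec_norm d (z : 'rV[R[i]]_d) : R :=
  Num.sqrt (\sum_j complex.Re `|z 0 j| ^+ 2).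

(* The norm of a normed module over R[i] is R[i]-valued (with real values). *)
Definition rnorm (Y : normedModType R[i]) (y : Y) : R := complex.Re `|y|.

(* Frechet differentiability over R[i], i.e. complex differentiability. *)
Definition entire d (Y : normedModType R[i]) (f : 'rV[R[i]]_d -> Y) : Prop :=
  forall z, differentiable f z.

Definition dilation d (Y : Type) (f : 'rV[R[i]]_d -> Y) (r : R) :
    'rV[R[i]]_d -> Y :=
  fun z => f (r%:C%C *: z).

Definition Gamma (s : R) : R :=
  \int[lebesgue_measure]_(t in `]0, +oo[) (t `^ (s - 1) * expR (- t)).

Section norms.
Variables (d : nat) (m beta : R) (Y : normedModType R[i]).
Implicit Type f : 'rV[R[i]]_d -> Y.

Definition fock_weight (z : 'rV[R[i]]_d) : R :=
  expR (- (beta / 2) * cvec_norm z `^ (2 * m)).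

Definition fock_constant : R :=
  m * beta `^ (d%:R / m) / pi ^+ d * (Gamma d%:R / Gamma (d%:R / m)).

(* The value +oo is allowed. *)
Definition fock_norm (p : R) f : \bar R :=
  ((fock_constant%:E *
    \int[iter_measure lebesgue_measure (d + d)]_t
      (rnorm ((fock_weight (complex_vector t))%:C%C *: f (complex_vector t))
         `^ p)%:E) `^ p^-1)%E.

Definition fock_norm_infty f : \bar R :=
  ereal_sup (range (fun z => (rnorm (f z) * fock_weight z)%:E)).

Definition fock (p : R) : set ('rV[R[i]]_d -> Y) :=
  [set f | entire f /\ (fock_norm p f < +oo)%E].

(* the filter |z| --> +oo *)
Definition cvec_infty : set_system 'rV[R[i]]_d :=
  filter_from setT (fun M : R => [set z | M < cvec_norm z]).

Definition fock_infty0 : set ('rV[R[i]]_d -> Y) :=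
  [set f | entire f /\ rnorm (f z) * fock_weight z @[z --> cvec_infty] --> 0].

End norms.
End fock_space.

(* Main.v *)
Require Import Defs.
From mathcomp Require Import all_boot all_order all_algebra complex.
From mathcomp Require Import all_classical all_reals all_analysis.
From mathcomp Require Import measurable_realfun ring lra.

Set Implicit Arguments.
Unset Strict Implicit.
Unset Printing Implicit Defensive.

Import Order.TTheory GRing.Theory Num.Theory.
Import numFieldNormedType.Exports.

Local Open Scope classical_set_scope.
Local Open Scope ring_scope.

(**
Two facts carry both parts: by continuity of f, its dilations f_r converge to
f locally uniformly, and the weight w(z) = exp(-(beta/2)|z|^(2m)) is radially
decreasing.

For 0 < r <= 1 one has w(z) <= w(rz), hence
w(z) |f_r(z)| <= (w |f|)(rz): the weighted dilation is dominated by the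
dilation of the weighted function.

For p finite, the Jacobian of z |-> rz on R^(2d) then gives
int (w |f_r|)^p <= r^(-2d) int (w |f|)^p, a bound that tends to int (w |f|)^p
as r tends to 1. Together with the pointwise convergence of f_r to f this
forces int (w |f - f_r|)^p to tend to 0: the integrand is bounded by
h_r = 2^p ((w |f|)^p + (w |f_r|)^p), which converges pointwise and whose
integrals do not exceed the integral of the limit asymptotically, so that
Fatou's lemma applied to h_r - (w |f - f_r|)^p yields the claim
(dominated_cvg_integral0). Fatou's lemma concerns sequences, so the limit
r --> 1^- is tested on sequences.

For p infinite and f vanishing at infinity against the weight, given e one
chooses M with w |f| < e/2 outside the ball of radius M. Outside the ball of
radius 2M both f and f_r (r > 1/2) are then small against w; on a compact cube
containing the latter ball f_r is uniformly close to f and w <= 1.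

To reach real analysis, C^d is parametrized by R^(2d) through complex_row,
and the product sigma-algebra on tuples is linked to the topology of row
vectors by approximating points by the nodes of a fine grid.
*)

(** * Real-valued norm of a complex normed module *)

Section complex_norm.
Variables (R : realType) (Y : normedModType R[i]).
Implicit Types (y : Y).

Lemma rnormE y : (rnorm y)%:C%C = `|y|.
Proof. by rewrite /rnorm RRe_real. Qed.

Lemma rnorm_ge0 y : 0 <= rnorm y.
Proof. by rewrite -ler0c rnormE. Qed.

Lemma ler_rnormB y1 y2 : rnorm (y1 - y2) <= rnorm y1 + rnorm y2.
Proof. by rewrite -lecR rmorphD /= !rnormE ler_normB. Qed.

Lemma rnormZ (c : R) y : 0 <= c -> rnorm (c%:C%C *: y) = c * rnorm y.
Proof.
move=> c0; apply: complexI; rewrite rmorphM /= !rnormE normrZ.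
by rewrite ger0_norm// ler0c.
Qed.

Lemma rnorm_continuous : continuous (@rnorm R Y).
Proof.
move=> y; apply/cvgrPdist_lt => e e0.
have e0' : 0 < e%:C%C :> R[i] by rewrite ltcR.
have /cvgrPdist_lt/(_ _ e0') := @cvg_id _ (nbhs y).
apply: filterS => z /=; rewrite -rnormE ltcR; apply: le_lt_trans.
rewrite ler_distl; apply/andP; split; rewrite ?lerBlDr -lecR rmorphD/= !rnormE.
  by rewrite distrC; have := ler_normD y (z - y); rewrite addrC subrK addrC.
by have := ler_normD z (y - z); rewrite addrC subrK.
Qed.

End complex_norm.

Lemma rnorm_comp_continuous (R : realType) (Y : normedModType R[i])
    (T : topologicalType) (g : T -> Y) :
  continuous g -> continuous (fun x => rnorm (g x)).
Proof.
by move=> cg x; exact: (cvg_comp _ _ (cg x) (@rnorm_continuous _ _ _)).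
Qed.

(** * Real coordinates on the complex vector space *)

Lemma cvg_mx (T : topologicalType) m n S (F : set_system S) {FF : Filter F}
    (f : S -> 'M[T]_(m, n)) (l : 'M[T]_(m, n)) :
  (forall i j, f s i j @[s --> F] --> l i j) -> f @ F --> l.
Proof.
move=> fl A [P lP PA]; rewrite /nbhs/= in PA *.
apply: (@filterS _ F _ (fun s => forall ij : 'I_m * 'I_n,
    P ij.1 ij.2 (f s ij.1 ij.2))).
  by move=> s fs; apply: PA => i j; exact: (fs (i, j)).
apply: filter_forall => -[i j]; exact: fl.
Qed.

Section complex_row.
Variable R : realType.

(** The codomain is spelled with an explicit [numFieldType] so that the normed
    topology of the complex numbers, under which differentiability is taken,
    is the one found by inference. *)
Definition complex_row d (x : 'rV[R]_(d + d)) : 'rV[(R[i] : numFieldType)]_d :=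
  \row_j (x 0 (lshift d j) +i* x 0 (rshift d j))%C.

Definition row_of_tuple n (t : n.-tuple R) : 'rV[R]_n := \row_i tnth t i.

Lemma complex_vectorE d (t : (d + d).-tuple R) :
  complex_vector t = complex_row (row_of_tuple t).
Proof. by apply/rowP => j; rewrite !mxE. Qed.

Lemma complex_rowZ d (r : R) (x : 'rV[R]_(d + d)) :
  complex_row (r *: x) = r%:C%C *: complex_row x.
Proof.
apply/rowP => j; rewrite !mxE; apply/eqP.
by rewrite eq_complex/= !mul0r subr0 addr0 !eqxx.
Qed.

Lemma complex_row_surj d (z : 'rV[R[i]]_d) :
  exists x, z = complex_row x.
Proof.
exists (row_mx (map_mx (@complex.Re R) z) (map_mx (@complex.Im R) z)).
by apply/rowP => j; rewrite mxE row_mxEl row_mxEr !mxE; case: (z 0 j).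
Qed.

Lemma real_complex_continuous :
  continuous (fun r : R => r%:C%C : (R[i] : numFieldType)).
Proof.
move=> r; apply/cvgrPdist_lt => e e0.
have eE : e = (complex.Re e)%:C%C by rewrite RRe_real// gtr0_real.
have Re0 : 0 < complex.Re e by rewrite -ltcR -eE.
have /cvgrPdist_lt/(_ _ Re0) := @cvg_id _ (nbhs r).
apply: filterS => s /=.
by rewrite -rmorphB normc_def/= expr0n/= addr0 sqrtr_sqr eE ltcR.
Qed.

Lemma complex_continuous (T : topologicalType) (a b : T -> R) :
  continuous a -> continuous b ->
  continuous (fun t => (a t +i* b t)%C : (R[i] : numFieldType)).
Proof.
move=> ca cb.
under [X in continuous X]eq_fun do rewrite [(_ +i* _)%C]complexE/=.
move=> t; apply: cvgD; last apply: cvgMr.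
  by apply: continuous_comp; [exact: ca|exact: real_complex_continuous].
by apply: continuous_comp; [exact: cb|exact: real_complex_continuous].
Qed.

Lemma complex_row_continuous d : continuous (@complex_row d).
Proof.
move=> x; apply: (@cvg_mx _ _ _ _ _ (nbhs_filter x)) => i j.
have ck k : continuous (fun y : 'rV[R]_(d + d) => y 0 k).
  exact: coord_continuous.
have := complex_continuous (ck (lshift d j)) (ck (rshift d j)).
move=> /(_ x) cc.
rewrite mxE; apply: cvg_trans cc; apply: near_eq_cvg.
by near=> y; rewrite mxE.
Unshelve. all: by end_near. Qed.

End complex_row.

Lemma entire_complex_row_continuous (R : realType) d (Y : normedModType R[i])
    (f : 'rV[R[i]]_d -> Y) :
  entire f -> continuous (f \o @complex_row R d).
Proof.
move=> ef x; apply: continuous_comp; first exact: complex_row_continuous.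
exact: differentiable_continuous.
Qed.

(** * Measurability of continuous functions of tuples *)

Section measurable_row.
Variables (R : realType) (n : nat).

Let grid (k : nat) (x : R) : int := Num.floor (k.+1%:R * x).

Let grid_cvg (x : R) : (grid k x)%:~R / k.+1%:R @[k --> \oo] --> x.
Proof.
have lo : x - harmonic k @[k --> \oo] --> x.
  rewrite -[X in _ --> X]subr0; apply: cvgB; first exact: cvg_cst.
  exact: cvg_harmonic.
apply: (squeeze_cvgr _ lo (@cvg_cst _ x _ _ _)).
apply: nearW => k; have /andP[] := floor_itv (k.+1%:R * x).
rewrite -/(grid k x) => fl fr; rewrite ler_pdivrMr// ler_pdivlMr//.
rewrite mulrC in fl; rewrite fl andbT mulrBl mulVf ?pnatr_eq0// lerBlDr mulrC.
by move: fr; rewrite rmorphD/= => /ltW.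
Qed.

(** The sigma-algebra on tuples is generated by coordinates, with no reference
    to open sets. Rounding each coordinate down to a multiple of 1/(k+1) takes
    countably many values, each on a finite intersection of coordinate
    conditions, so rounding before applying [g] gives a measurable function;
    let [k] tend to infinity. *)
Lemma measurable_continuous_row (g : 'rV[R]_n -> R) : continuous g ->
  measurable_fun setT (g \o @row_of_tuple R n).
Proof.
move=> cg.
pose q k (t : n.-tuple R) : 'rV[R]_n :=
  \row_i ((grid k (tnth t i))%:~R / k.+1%:R).
apply: (@measurable_fun_cvg _ _ _ _ (fun k => g \o q k)) => [k|t _]; last first.
  apply: continuous_cvg; first exact: cg.
  apply: (@cvg_mx _ _ _ _ _ _) => i j; rewrite mxE.
  rewrite (_ : (fun k => _) =
      (fun k => (grid k (tnth t j))%:~R / k.+1%:R)); last first.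
    by apply/funext => k; rewrite mxE.
  exact: grid_cvg.
move=> _ Y mY; rewrite setTI.
pose cell (c : {ffun 'I_n -> int}) : set (n.-tuple R) :=
  [set t | Y (g (\row_i ((c i)%:~R / k.+1%:R))) /\
           forall i, grid k (tnth t i) = c i].
rewrite (_ : _ @^-1` Y = \bigcup_c cell c); last first.
  apply/seteqP; split => [t Yt|t [c _ [Yc tc]]].
    exists [ffun i => grid k (tnth t i)] => //.
    split => [|i]; last by rewrite ffunE.
    move: Yt; rewrite /= /q; congr (Y (g _)).
    by apply/rowP => i; rewrite !mxE ffunE.
  rewrite /= /q; move: Yc; congr (Y (g _)).
  by apply/rowP => i; rewrite !mxE tc.
apply: countable_bigcupT_measurable => [|c]; first exact: countableP.
have [Yc|nYc] := pselect (Y (g (\row_i ((c i)%:~R / k.+1%:R)))); last first.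
  by rewrite (_ : cell c = set0)//; apply/seteqP; split => // t [].
rewrite (_ : cell c = \bigcap_(i in [set: 'I_n])
    (@tnth n R ^~ i @^-1` [set x | grid k x = c i])); last first.
  apply/seteqP; split => [t [_ tc] i _ /=|t tc]; first exact: tc.
  by split => // i; exact: tc.
apply: fin_bigcap_measurable => // i _; rewrite -[X in measurable X]setTI.
apply: measurable_tnth => //.
rewrite (_ : [set x | _] = *%R k.+1%:R @^-1` `[(c i)%:~R, (c i + 1)%:~R[).
  rewrite -[X in measurable X]setTI; exact: mulrl_measurable.
apply/seteqP; split => x /=; rewrite in_itv/= /grid.
  by move=> <-; exact: floor_itv.
exact: floor_def.
Qed.

End measurable_row.

(** * Dilations and the iterated Lebesgue measure *)

Section dilation_invariance.
Variable R : realType.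
Local Open Scope ereal_scope.

Local Notation mu := (@lebesgue_measure R).

Local Notation scale r := ( *%R r : measurableTypeR R -> measurableTypeR R).

Lemma lebesgue_measure_scale (r : R) (A : set (measurableTypeR R)) :
  (0 < r)%R -> measurable A -> pushforward mu (scale r) A = r^-1%:E * mu A.
Proof.
move=> r0 mA.
have mr : measurable_fun setT (scale r).
  exact: mulrl_measurable.
pose rr := NngNum (ltW r0).
suff : mu A = pushforward (mscale rr mu) (scale r) A.
  move=> ->; rewrite /pushforward /mscale/= muleA -EFinM mulVf ?gt_eqF//.
  by rewrite mul1e.
apply: lebesgue_measure_unique => //= _ [[a b]] /= ab <-.
rewrite /pushforward /mscale /=.
rewrite (_ : _ @^-1` _ = `](a / r)%R, (b / r)%R]%classic); last first.
  apply/seteqP; split => x /=; rewrite !in_itv/= ltr_pdivrMr// ler_pdivlMr//;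
    by rewrite mulrC.
rewrite !lebesgue_measure_itv/= !lte_fin ltr_pM2r ?invr_gt0//.
case: ifPn => _; last by rewrite mule0.
by rewrite -!EFinB -EFinM; congr EFin; field; rewrite gt_eqF.
Qed.

Lemma ge0_integral_scale (r : R) (f : R -> \bar R) : (0 < r)%R ->
  measurable_fun setT f -> (forall x, 0 <= f x) ->
  \int[mu]_x f (r * x)%R = r^-1%:E * \int[mu]_x f x.
Proof.
move=> r0 mf f0.
have mr : measurable_fun setT (scale r).
  exact: mulrl_measurable.
have r0' : (0 <= r^-1)%R by rewrite invr_ge0 ltW.
transitivity (\int[pushforward mu (scale r)]_x f x).
  by rewrite ge0_integral_pushforward.
rewrite (eq_measure_integral (mscale (NngNum r0') mu)); last first.
  by move=> A mA _; exact: lebesgue_measure_scale.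
by rewrite ge0_integral_mscale.
Qed.

Definition tuple_scale n (r : R) (t : n.-tuple R) : n.-tuple R :=
  [tuple of map ( *%R r) t].

Lemma row_of_tuple_scale n (r : R) (t : n.-tuple R) :
  row_of_tuple (tuple_scale r t) = r *: row_of_tuple t.
Proof. by apply/rowP => i; rewrite !mxE tnth_map. Qed.

Lemma measurable_tuple_scale n r : measurable_fun setT (@tuple_scale n r).
Proof.
apply/measurable_fun_tnthP => i.
rewrite (_ : _ \o _ = ( *%R r \o @tnth n R ^~ i)); last first.
  by apply/funext => t; rewrite /= tnth_map.
by apply: measurableT_comp; [exact: mulrl_measurable|exact: measurable_tnth].
Qed.

(** Tonelli's theorem in the recursive description of the iterated measure;
    inductions on the dimension go through it. *)
Lemma ge0_integral_iter_measureS n (f : n.+1.-tuple R -> \bar R) :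
  measurable_fun setT f -> (forall t, 0 <= f t) ->
  \int[iter_measure mu n.+1]_t f t =
  \int[mu]_x \int[iter_measure mu n]_t f (tuple_cons (x, t)).
Proof.
move=> mf f0.
transitivity (\int[pushforward (mu \x iter_measure mu n)
                               (@tuple_cons _ _ n)]_t f t).
  by [].
rewrite ge0_integral_pushforward//; last exact: measurable_tuple_cons.
rewrite fubini_tonelli1//; last by move=> x; exact: f0.
by apply: measurableT_comp => //; exact: measurable_tuple_cons.
Qed.

Lemma ge0_integral_iter_measure_scale n (r : R) (f : n.-tuple R -> \bar R) :
  (0 < r)%R -> measurable_fun setT f -> (forall t, 0 <= f t) ->
  \int[iter_measure mu n]_t f (tuple_scale r t) =
  (r^-1 ^+ n)%:E * \int[iter_measure mu n]_t f t.
Proof.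
move=> r0; elim: n f => [|n IH] f mf f0.
  rewrite expr0 mul1e; apply: eq_integral => t _.
  by rewrite (tuple0 t) (tuple0 (tuple_scale _ _)).
have mcons x :
    measurable_fun setT (fun t : n.-tuple R => f (tuple_cons (x, t))).
  apply: measurableT_comp => //.
  apply: (measurableT_comp (@measurable_tuple_cons _ _ n)).
  exact: measurable_pair1.
rewrite ge0_integral_iter_measureS//; last first.
  apply: measurableT_comp => //; exact: measurable_tuple_scale.
rewrite ge0_integral_iter_measureS//.
transitivity (\int[mu]_x ((r^-1 ^+ n)%:E *
    \int[iter_measure mu n]_t f (tuple_cons ((r * x)%R, t)))).
  apply: eq_integral => x _; rewrite -IH//.
  by apply: eq_integral => t _; congr f; apply/val_inj.
have mF : measurable_fun setT
    (fun x => \int[iter_measure mu n]_t f (tuple_cons (x, t))).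
  apply: (measurable_fun_fubini_tonelli_F (m2 := iter_measure mu n)
    (f \o @tuple_cons _ _ n)); last by move=> x; exact: f0.
  by apply: measurableT_comp => //; exact: measurable_tuple_cons.
have F0 x : 0 <= \int[iter_measure mu n]_t f (tuple_cons (x, t)).
  exact: integral_ge0.
have mFr : measurable_fun setT
    (fun x => \int[iter_measure mu n]_t f (tuple_cons ((r * x)%R, t))).
  exact: (measurableT_comp mF (mulrl_measurable r)).
have rn0 : 0 <= (r^-1 ^+ n)%:E by rewrite lee_fin exprn_ge0// invr_ge0 ltW.
rewrite ge0_integralZl//; last by move=> x _; exact: F0.
rewrite (@ge0_integral_scale _ (fun x =>
  \int[iter_measure mu n]_t f (tuple_cons (x, t))))//.
by rewrite muleA -EFinM exprSr.
Qed.

End dilation_invariance.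

(** * Limits *)

Section powR_limits.
Variable R : realType.

(** [powR ^~ p] is differentiable away from 0, whence the case [0 < l]; at
    [l = 0] it may fail to be, but it is increasing. *)
Lemma cvg_powR (T : Type) (F : set_system T) {FF : Filter F} (u : T -> R)
    (l p : R) :
  0 < p -> (forall x, 0 <= u x) -> 0 <= l -> u x @[x --> F] --> l ->
  u x `^ p @[x --> F] --> l `^ p.
Proof.
move=> p0 u0; rewrite le_eqVlt => /predU1P[<-|l0] ul.
  rewrite powR0 ?gt_eqF//; apply/cvgrPdist_lt => e e0.
  have ep0 : 0 < e `^ p^-1 by exact: powR_gt0.
  have /cvgrPdist_lt/(_ _ ep0) := ul.
  apply: filterS => x; rewrite !sub0r !normrN !ger0_norm ?powR_ge0// => ux.
  have : (u x `^ p) < (e `^ p^-1) `^ p.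
    by rewrite gt0_ltr_powR// ?nnegrE ?powR_ge0.
  by rewrite -powRrM mulVf ?gt_eqF// powRr1// ltW.
have cp : {for l, continuous (fun a : R => a `^ p)}.
  apply: differentiable_continuous; apply/derivable1_diffP.
  by apply: derivable_powR; rewrite in_itv/= l0.
exact: (cvg_comp u _ ul cp).
Qed.

(** Because [a + b] is at most twice the larger of [a] and [b]. *)
Lemma powRD_le (a b p : R) : 0 <= p -> 0 <= a -> 0 <= b ->
  (a + b) `^ p <= 2 `^ p * (a `^ p + b `^ p).
Proof.
move=> p0 a0 b0.
wlog ab : a b a0 b0 / a <= b.
  move=> H; have [ab|/ltW ba] := leP a b; first exact: H.
  by rewrite addrC [X in _ <= _ * X]addrC; exact: H.
apply: (@le_trans _ _ ((2 * b) `^ p)).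
  by apply: ge0_ler_powR; rewrite ?nnegrE ?addr_ge0 ?mulr_ge0//; lra.
by rewrite powRM// ler_wpM2l ?powR_ge0// lerDr powR_ge0.
Qed.

Lemma cvge_0P (T : Type) (F : set_system T) {FF : Filter F} (u : T -> \bar R) :
  (forall x, (0 <= u x)%E) ->
  (u x @[x --> F] --> 0%E <->
   forall e, 0 < e -> \forall x \near F, (u x <= e%:E)%E).
Proof.
move=> u0; split => [u_0 e e0|H].
  have e0' : (0 < e%:E)%E by rewrite lte_fin.
  have ue : \forall x \near F, (u x < e%:E)%E.
    exact: (u_0 _ (open_ereal_lt' e0')).
  by apply: filterS ue => x /ltW.
have fin x e : (u x <= e%:E)%E -> u x \is a fin_num.
  by move=> ue; rewrite ge0_fin_numE// (le_lt_trans ue)// ltry.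
apply/fine_cvgP; split; first by have := H 1 ltr01; apply: filterS => x /fin.
apply/cvgrPdist_le => e e0; have := H e e0; apply: filterS => x ux.
by rewrite sub0r normrN ger0_norm ?fine_ge0// -lee_fin fineK// (fin _ _ ux).
Qed.

End powR_limits.

Section generalized_dominated_convergence.
Local Open Scope ereal_scope.
Context d (T : measurableType d) (R : realType).
Variable mu : {measure set T -> \bar R}.

Lemma near_limn_einf_gt (u : (\bar R)^nat) (l : \bar R) :
  l < limn_einf u -> \forall n \near \oo, l < u n.
Proof.
rewrite limn_einf_lim (cvg_lim _ (@cvg_einfs_sup _ u))// => lu.
have [_ [N _ <-] lN] := ereal_sup_gt lu.
exists N => // n /= Nn; apply: (lt_le_trans lN).
by apply: ereal_inf_lbound; exists n.
Qed.

(** Dominated convergence with dominating functions that vary with [n]. By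
    Fatou's lemma for [h n - a n], which tends to [hl], the limit inferior of
    the integrals of [h n - a n] is at least [l], while the integrals of [h n]
    are at most [b n --> l]: nothing is left for those of [a n]. *)
Lemma dominated_cvg_integral0 (a h : nat -> T -> R) (hl : T -> R)
    (b : nat -> R) (l : R) :
  (forall n, measurable_fun setT (a n)) ->
  (forall n, measurable_fun setT (h n)) ->
  (forall n x, 0 <= a n x <= h n x)%R ->
  (forall x, a n x @[n --> \oo] --> 0%R) ->
  (forall x, h n x @[n --> \oo] --> hl x) ->
  \int[mu]_x (hl x)%:E = l%:E ->
  (\forall n \near \oo, \int[mu]_x (h n x)%:E <= (b n)%:E) ->
  b n @[n --> \oo] --> l ->
  \int[mu]_x (a n x)%:E @[n --> \oo] --> 0.
Proof.
move=> ma mh ah a0 hhl il hb bl.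
have a_ge0 n x : (0 <= a n x)%R by have /andP[] := ah n x.
have hBa_ge0 n x : (0 <= h n x - a n x)%R.
  by rewrite subr_ge0; have /andP[] := ah n x.
have h_ge0 n x : (0 <= h n x)%R.
  by have /andP[a0h ha] := ah n x; exact: le_trans ha.
have mhBa n : measurable_fun setT (fun x => (h n x - a n x)%:E).
  by apply/measurable_EFinP; exact: measurable_funB.
have fat : l%:E <= limn_einf (fun n => \int[mu]_x (h n x - a n x)%:E).
  apply: le_trans (fatou mu measurableT mhBa _); last first.
    by move=> n x _; rewrite lee_fin.
  rewrite -il le_eqVlt; apply/orP; left; apply/eqP.
  apply: eq_integral => x _; apply/esym.
  have hx : (h n x - a n x)%:E @[n --> \oo] --> (hl x)%:E.
    apply: cvg_EFin; first exact: nearW.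
    by rewrite -[X in _ --> X]subr0; apply: cvgB; [exact: hhl|exact: a0].
  rewrite is_cvg_limn_einfE; first exact/cvg_lim.
  by apply/cvg_ex; eexists; exact: hx.
have split n : \int[mu]_x (h n x)%:E =
    \int[mu]_x (h n x - a n x)%:E + \int[mu]_x (a n x)%:E.
  rewrite -ge0_integralD//; first last.
  - exact/measurable_EFinP.
  - by move=> x _; rewrite lee_fin.
  - by move=> x _; rewrite lee_fin.
  by apply: eq_integral => x _; rewrite -EFinD subrK.
have A0 n : 0 <= \int[mu]_x (a n x)%:E.
  by apply: integral_ge0 => x _; rewrite lee_fin.
have X0 n : 0 <= \int[mu]_x (h n x - a n x)%:E.
  by apply: integral_ge0 => x _; rewrite lee_fin.
apply/cvge_0P => // e e0; have e20 : (0 < e / 2)%R by rewrite divr_gt0.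
have nX : \forall n \near \oo, (l - e / 2)%:E < \int[mu]_x (h n x - a n x)%:E.
  apply: near_limn_einf_gt; apply: lt_le_trans fat.
  by rewrite lte_fin ltrBlDr ltrDl.
have /cvgrPdist_lt/(_ _ e20) nb := bl.
near=> n.
have bn : (b n < l + e / 2)%R.
  have : (`|l - b n| < e / 2)%R by near: n.
  by rewrite ltr_distlC => /andP[].
have Xn : (l - e / 2)%:E < \int[mu]_x (h n x - a n x)%:E by near: n.
have : \int[mu]_x (h n x)%:E <= (b n)%:E by near: n.
rewrite split; move: (A0 n) (X0 n) Xn.
case: (integral _ _ _) => [x| |]; case: (integral _ _ _) => [y| |]//=.
rewrite !lee_fin !lte_fin => _ _; lra.
Unshelve. all: by end_near. Qed.

End generalized_dominated_convergence.

Lemma ge0_integral_scaleD d (T : measurableType d) (R : realType)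
    (mu : {measure set T -> \bar R}) (c : R) (g h : T -> R) : 0 <= c ->
  measurable_fun setT g -> measurable_fun setT h ->
  (forall t, 0 <= g t) -> (forall t, 0 <= h t) ->
  (\int[mu]_t (c * (g t + h t))%:E =
   c%:E * (\int[mu]_t (g t)%:E + \int[mu]_t (h t)%:E))%E.
Proof.
move=> c0 /measurable_EFinP mg /measurable_EFinP mh g0 h0.
rewrite -ge0_integralD//; [|by move=> t _; rewrite lee_fin..].
rewrite -ge0_integralZl//; first exact: emeasurable_funD.
by move=> t _; rewrite adde_ge0// lee_fin.
Qed.

(** * The Fock weight *)

Section weight.
Variables (R : realType) (d : nat) (m beta : R).
Hypotheses (m0 : 0 <= m) (beta0 : 0 <= beta).
Local Notation w := (@fock_weight R d m beta).

Lemma cvec_norm_complex_row (x : 'rV[R]_(d + d)) :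
  cvec_norm (complex_row x) =
  Num.sqrt (\sum_j (x 0 (lshift d j) ^+ 2 + x 0 (rshift d j) ^+ 2)).
Proof.
congr Num.sqrt; apply: eq_bigr => j _; rewrite mxE normc_def/= sqr_sqrtr//.
by rewrite addr_ge0 ?sqr_ge0.
Qed.

Lemma cvec_norm_ge0 (z : 'rV[R[i]]_d) : 0 <= cvec_norm z.
Proof. exact: sqrtr_ge0. Qed.

Lemma cvec_normZ (r : R) (z : 'rV[R[i]]_d) : 0 <= r ->
  cvec_norm (r%:C%C *: z) = r * cvec_norm z.
Proof.
move=> r0; have [x ->] := complex_row_surj z.
rewrite -complex_rowZ !cvec_norm_complex_row.
rewrite -[X in _ = X * _](ger0_norm r0) -sqrtr_sqr.
rewrite -sqrtrM ?sqr_ge0//.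
by rewrite mulr_sumr; congr Num.sqrt; apply: eq_bigr => j _; rewrite !mxE; ring.
Qed.

Lemma le_cvec_norm (x : 'rV[R]_(d + d)) k :
  `|x 0 k| <= cvec_norm (complex_row x).
Proof.
rewrite cvec_norm_complex_row -sqrtr_sqr; apply: ler_wsqrtr.
have pos j : 0 <= x 0 (lshift d j) ^+ 2 + x 0 (rshift d j) ^+ 2.
  by rewrite addr_ge0 ?sqr_ge0.
case: (split_ordP k) => j ->; rewrite (bigD1 j)//=.
  by rewrite -addrA lerDl addr_ge0 ?sqr_ge0// sumr_ge0.
by rewrite addrAC lerDr addr_ge0 ?sqr_ge0// sumr_ge0.
Qed.

Lemma fock_weight_ge0 z : 0 <= w z.
Proof. exact: expR_ge0. Qed.

Lemma fock_weight_le1 z : w z <= 1.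
Proof.
rewrite -expR0 ler_expR mulNr oppr_le0 mulr_ge0 ?powR_ge0//.
by rewrite divr_ge0.
Qed.

Lemma fock_weight_dilation (r : R) z : 0 <= r <= 1 -> w z <= w (r%:C%C *: z).
Proof.
move=> /andP[r0 r1]; rewrite ler_expR !mulNr lerN2.
apply: ler_wpM2l; first by rewrite divr_ge0.
apply: ge0_ler_powR; rewrite ?nnegrE ?mulr_ge0 ?cvec_norm_ge0//.
by rewrite cvec_normZ// ler_piMl// cvec_norm_ge0.
Qed.

Lemma measurable_fock_weight :
  measurable_fun setT (fun t => w (complex_vector t)).
Proof.
apply: measurableT_comp => //; apply: measurable_funM => //.
apply: (measurableT_comp (measurable_powR (2 * m))
  (g := fun t : (d + d).-tuple R => cvec_norm (complex_vector t))).
under [X in measurable_fun _ X]eq_fun do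
  rewrite complex_vectorE cvec_norm_complex_row.
have msqrt : measurable_fun setT (@Num.sqrt R).
  by apply: continuous_measurable_fun; exact: sqrt_continuous.
apply: (measurableT_comp msqrt).
apply: measurable_sum => j; apply: measurable_funD; apply: measurable_funX.
  under [X in measurable_fun _ X]eq_fun do rewrite mxE.
  exact: measurable_tnth.
under [X in measurable_fun _ X]eq_fun do rewrite mxE.
exact: measurable_tnth.
Qed.

End weight.

(** * Local convergence of dilations *)

Section dilation_limits.
Variables (R : realType) (Y : normedModType R[i]) (n : nat).
Variable F : 'rV[R]_n -> Y.
Hypothesis cF : continuous F.

Lemma scale_comp_continuous :
  continuous (fun q : R * 'rV[R]_n => F (q.1 *: q.2)).
Proof.
move=> q.
have qZ : (p.1 *: p.2) @[p --> q] --> q.1 *: q.2.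
  by apply: cvgZ; [exact: cvg_fst|exact: cvg_snd].
exact: (cvg_comp _ _ qZ (@cF _)).
Qed.

Lemma dilation_continuous (r : R) :
  continuous (fun x : 'rV[R]_n => F (r *: x)).
Proof.
move=> x.
have rx : (r *: y) @[y --> x] --> r *: x.
  exact: scaler_continuous.
exact: (cvg_comp _ _ rx (@cF _)).
Qed.

Lemma dilation_sub_continuous :
  continuous (fun q : R * 'rV[R]_n => rnorm (F q.2 - F (q.1 *: q.2))).
Proof.
move=> q.
have c2 : F p.2 @[p --> q] --> F q.2.
  have s2 : p.2 @[p --> q] --> q.2 by exact: cvg_snd.
  exact: (cvg_comp _ _ s2 (@cF _)).
exact: (cvg_comp _ _ (cvgB c2 (@scale_comp_continuous q))
  (@rnorm_continuous _ _ _)).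
Qed.

Lemma pair_cvg (x : 'rV[R]_n) (u : nat -> R) : u k @[k --> \oo] --> (1 : R) ->
  (u k, x) @[k --> \oo] --> ((1 : R), x).
Proof.
by move=> u1; exact: (cvg_pair (f := u) (g := fun=> x) u1 (cvg_cst x)).
Qed.

Lemma dilation_cvg (x : 'rV[R]_n) (u : nat -> R) :
  u k @[k --> \oo] --> (1 : R) ->
  rnorm (F (u k *: x)) @[k --> \oo] --> rnorm (F x).
Proof.
move=> /pair_cvg => /(_ x) u1.
have := cvg_comp _ _ (cvg_comp _ _ u1 (@scale_comp_continuous (1, x)))
  (@rnorm_continuous _ _ _).
by rewrite scale1r.
Qed.

Lemma dilation_sub_cvg (x : 'rV[R]_n) (u : nat -> R) :
  u k @[k --> \oo] --> (1 : R) ->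
  rnorm (F x - F (u k *: x)) @[k --> \oo] --> 0.
Proof.
move=> /pair_cvg => /(_ x) u1.
have := cvg_comp _ _ u1 (@dilation_sub_continuous (1, x)).
by rewrite /= scale1r subrr /rnorm normr0.
Qed.

(** Joint continuity of [(r, x) |-> F x - F (r *: x)], which vanishes at
    [r = 1], makes the estimate hold near each point of [K] for [r] near 1;
    compactness makes the range of [r] uniform. *)
Lemma dilation_unif (K : set 'rV[R]_n) (e : R) : compact K -> 0 < e ->
  \forall r \near (1 : R), forall x, K x -> rnorm (F x - F (r *: x)) < e.
Proof.
move=> /compact_near_coveringP cK e0.
apply: (cK _ (nbhs (1 : R)) (fun r x => rnorm (F x - F (r *: x)) < e)) => x Kx.
have := @dilation_sub_continuous (1, x).
rewrite /continuous_at/= scale1r subrr {2}/rnorm normr0.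
move=> /cvgrPdist_lt/(_ _ e0) H.
have sw : (q.2, q.1) @[q --> (x, (1 : R))] --> ((1 : R), x).
  exact: (cvg_pair (f := snd) (g := fst) cvg_snd cvg_fst).
have {H}sw : \forall q \near (x, (1 : R)),
    `|0 - rnorm (F q.1 - F (q.2 *: q.1))| < e.
  exact: (sw _ H).
apply: filterS sw => -[y r] /=.
by rewrite sub0r normrN ger0_norm// rnorm_ge0.
Qed.

End dilation_limits.

(** * Finite exponents *)

Section finite_exponent.
Variables (R : realType) (d : nat) (m beta p : R) (Y : normedModType R[i]).
Hypotheses (m0 : 0 <= m) (beta0 : 0 <= beta) (p1 : 1 <= p).
Variable f : 'rV[R[i]]_d -> Y.
Local Notation mu := (iter_measure (@lebesgue_measure R) (d + d)).
Local Notation F := (f \o @complex_row R d).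
Local Notation w :=
  (fun t : (d + d).-tuple R => fock_weight m beta (complex_vector t)).
Local Notation C := (@fock_constant R d m beta).

Lemma Gamma_ge0 (s : R) : 0 <= Gamma s.
Proof.
by apply: Rintegral_ge0 => // t _; rewrite mulr_ge0 ?powR_ge0 ?expR_ge0.
Qed.

Lemma fock_constant_ge0 : 0 <= C.
Proof.
rewrite /fock_constant mulr_ge0//; last by rewrite divr_ge0 ?Gamma_ge0.
by rewrite divr_ge0 ?exprn_ge0 ?pi_ge0// mulr_ge0 ?powR_ge0.
Qed.

Lemma fock_normE (g : 'rV[R[i]]_d -> Y) : fock_norm m beta p g =
  ((C%:E * \int[mu]_t
     ((w t * rnorm (g (complex_vector t))) `^ p)%:E) `^ p^-1)%E.
Proof.
rewrite /fock_norm; congr ((_ * _) `^ _)%E; apply: eq_integral => t _.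
by rewrite rnormZ// fock_weight_ge0.
Qed.

Lemma measurable_weighted_powR (g : 'rV[R]_(d + d) -> R) : continuous g ->
  measurable_fun setT (fun t => (w t * g (row_of_tuple t)) `^ p).
Proof.
move=> cg; apply: (measurableT_comp (measurable_powR p)
  (g := fun t => w t * g (row_of_tuple t))).
apply: measurable_funM; first exact: measurable_fock_weight.
exact: measurable_continuous_row.
Qed.

(** The weight only grows when its argument is replaced by its dilate, and
    the change of variables costs the Jacobian [r^-1 ^+ (d + d)]. *)
Lemma fock_dilation_integral_le (r : R) : continuous F -> 0 < r <= 1 ->
  (\int[mu]_t ((w t * rnorm (F (r *: row_of_tuple t))) `^ p)%:E <=
   (r^-1 ^+ (d + d))%:E *
     \int[mu]_t ((w t * rnorm (F (row_of_tuple t))) `^ p)%:E)%E.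
Proof.
move=> cF /andP[r0 r1].
have cN := rnorm_comp_continuous cF.
have cNr := rnorm_comp_continuous (@dilation_continuous _ _ _ _ cF r).
pose h t := ((w t * rnorm (F (row_of_tuple t))) `^ p)%:E.
have mh : measurable_fun setT h.
  by apply/measurable_EFinP; exact: measurable_weighted_powR cN.
have h0 t : (0 <= h t)%E by rewrite lee_fin powR_ge0.
rewrite -(ge0_integral_iter_measure_scale r0 mh h0).
apply: ge0_le_integral => //.
- by move=> t _; rewrite lee_fin powR_ge0.
- by apply/measurable_EFinP; exact: measurable_weighted_powR cNr.
- by apply: measurableT_comp => //; exact: measurable_tuple_scale.
move=> t _; rewrite lee_fin /h row_of_tuple_scale.
have p0 : 0 <= p by exact: le_trans p1.
apply: (ge0_ler_powR p0).
- by rewrite nnegrE; apply: mulr_ge0; [exact: fock_weight_ge0|exact: rnorm_ge0].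
- by rewrite nnegrE; apply: mulr_ge0; [exact: fock_weight_ge0|exact: rnorm_ge0].
apply: ler_wpM2r; first exact: rnorm_ge0.
rewrite !complex_vectorE row_of_tuple_scale complex_rowZ.
by apply: fock_weight_dilation => //; rewrite ltW.
Qed.

Lemma fock_integral_dilation_cvg (L : R) : continuous F ->
  (\int[mu]_t ((w t * rnorm (F (row_of_tuple t))) `^ p)%:E = L%:E)%E ->
  (\int[mu]_t ((w t * rnorm (F (row_of_tuple t) - F (r *: row_of_tuple t)))
                `^ p)%:E)%E
    @[r --> 1^'-] --> 0%E.
Proof.
move=> cF IL; apply/cvge_at_leftP => u [u1 ucvg].
pose a n t :=
  (w t * rnorm (F (row_of_tuple t) - F (u n *: row_of_tuple t))) `^ p.
pose N t := (w t * rnorm (F (row_of_tuple t))) `^ p.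
pose Nr n t := (w t * rnorm (F (u n *: row_of_tuple t))) `^ p.
have p0 : 0 < p by exact: lt_le_trans p1.
have w0 t : 0 <= w t by exact: fock_weight_ge0.
have wn0 t y : 0 <= w t * rnorm (y : Y).
  by apply: mulr_ge0; [exact: fock_weight_ge0|exact: rnorm_ge0].
have cN := rnorm_comp_continuous cF.
have cNr r := rnorm_comp_continuous (@dilation_continuous _ _ _ _ cF r).
have cD r : continuous (fun x : 'rV[R]_(d + d) => rnorm (F x - F (r *: x))).
  apply: rnorm_comp_continuous => x.
  exact: (cvgB (@cF x) (@dilation_continuous _ _ _ _ cF r x)).
have mN : measurable_fun setT N by exact: measurable_weighted_powR cN.
have mNr n : measurable_fun setT (Nr n).
  exact: measurable_weighted_powR (cNr _).
have N0 t : 0 <= N t by exact: powR_ge0.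
have Nr0 n t : 0 <= Nr n t by exact: powR_ge0.
have p20 : 0 <= 2 `^ p :> R by exact: powR_ge0.
suff : (\int[mu]_t (a n t)%:E)%E @[n --> \oo] --> 0%E by [].
apply: (@dominated_cvg_integral0 _ _ _ mu a
  (fun n t => 2 `^ p * (N t + Nr n t)) (fun t => 2 `^ p * (N t + N t))
  (fun n => 2 `^ p * (L + (u n)^-1 ^+ (d + d) * L)) (2 `^ p * (L + L))).
- by move=> n; exact: measurable_weighted_powR (cD _).
- move=> n; apply: measurable_funM; first exact: measurable_cst.
  exact: (measurable_funD mN (mNr n)).
- move=> n t; rewrite powR_ge0/=.
  apply: (@le_trans _ _ ((w t * rnorm (F (row_of_tuple t)) +
      w t * rnorm (F (u n *: row_of_tuple t))) `^ p)).
    apply: (ge0_ler_powR (ltW p0)); first exact: wn0.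
      by rewrite nnegrE; exact: addr_ge0.
    by rewrite -mulrDr; apply: ler_wpM2l; [exact: w0|exact: ler_rnormB].
  by apply: powRD_le; [exact: ltW|exact: wn0|exact: wn0].
- move=> t; rewrite -(@powR0 _ p) ?gt_eqF//; apply: cvg_powR => //.
  rewrite -(mulr0 (w t)); apply: cvgMr; exact: dilation_sub_cvg.
- move=> t; apply: cvgMr; apply: cvgD; first exact: cvg_cst.
  apply: cvg_powR => //.
  by apply: cvgMr; exact: dilation_cvg.
- by rewrite ge0_integral_scaleD// /N IL.
(* The sequence [u] is only known to be below 1, so that its first terms may be
   nonpositive, where the change of variables does not apply. *)
- have : \forall n \near \oo, 0 < u n.
    have /cvgrPdist_lt/(_ _ ltr01) := ucvg; apply: filterS => n.
    by rewrite ltr_distl => /andP[_ +]; lra.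
  apply: filterS => n un0.
  rewrite ge0_integral_scaleD//; last exact: mNr.
  rewrite EFinM lee_wpmul2l ?lee_fin// EFinD IL leeD2l// EFinM -IL.
  by apply: fock_dilation_integral_le => //; rewrite un0 ltW.
- have uV : (u n)^-1 @[n --> \oo] --> (1 : R).
    by rewrite -[X in _ --> X]invr1; apply: cvgV => //; exact: oner_neq0.
  have uX : (u n)^-1 ^+ (d + d) @[n --> \oo] --> (1 : R).
    rewrite -[X in _ --> X](expr1n _ (d + d)).
    exact: (cvg_comp _ _ uV (@exprn_continuous _ _ _)).
  have uXL : (u n)^-1 ^+ (d + d) * L @[n --> \oo] --> L.
    by rewrite -[X in _ --> X]mul1r; exact: cvgMl.
  by apply: cvgMr; apply: cvgD uXL; exact: cvg_cst.
Qed.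

Lemma fock_dilation_cvg : fock m beta p f ->
  fock_norm m beta p (f - dilation f r) @[r --> 1^'-] --> 0%E.
Proof.
move=> [ef]; rewrite fock_normE => fin.
have p0 : 0 < p by exact: lt_le_trans p1.
have pV0 : p^-1 != 0 by rewrite invr_eq0 gt_eqF.
have cF := entire_complex_row_continuous ef.
pose I := (\int[mu]_t ((w t * rnorm (F (row_of_tuple t))) `^ p)%:E)%E.
pose J r := (\int[mu]_t
  ((w t * rnorm (F (row_of_tuple t) - F (r *: row_of_tuple t))) `^ p)%:E)%E.
have I0 : (0 <= I)%E by apply: integral_ge0 => t _; rewrite lee_fin powR_ge0.
have J0 r : (0 <= J r)%E.
  by apply: integral_ge0 => t _; rewrite lee_fin powR_ge0.
have IE : (\int[mu]_t ((w t * rnorm (f (complex_vector t))) `^ p)%:E)%E = I.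
  by apply: eq_integral => t _; rewrite /= -complex_vectorE.
have JE r : fock_norm m beta p (f - dilation f r) = ((C%:E * J r) `^ p^-1)%E.
  rewrite fock_normE; congr ((_ * _) `^ _)%E; apply: eq_integral => t _.
  by rewrite /= complex_rowZ -complex_vectorE.
under eq_fun do rewrite JE.
(* A zero constant would make every norm 0, since [0 * +oo = 0]. *)
have := fock_constant_ge0; rewrite le_eqVlt => /predU1P[<-|C0].
  under eq_fun do rewrite mul0e poweR0r//.
  exact: cvg_cst.
have If : I \is a fin_num.
  rewrite ge0_fin_numE//; move: fin => /(lty_poweRy pV0); rewrite IE.
  case: (I) I0 => [r _ _||]//; first exact: ltry.
  by rewrite gt0_muley ?lte_fin// ltxx.
have := fock_integral_dilation_cvg cF (esym (fineK If)).
move/cvge_0P => /(_ J0) JC; apply/cvge_0P => [r|e e0]; first exact: poweR_ge0.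
have eC : 0 < e `^ p / C by rewrite divr_gt0 ?powR_gt0.
have := JC _ eC; apply: filterS => r; rewrite -/(J r) => Jr.
rewrite -[e]powRr1 ?(ltW e0)// -(mulfV (lt0r_neq0 p0)) powRrM -poweR_EFin.
apply: gt0_ler_poweR; rewrite ?invr_ge0 ?(ltW p0)// ?in_itv/= ?leey ?andbT.
- by rewrite mule_ge0// lee_fin ltW.
- by rewrite lee_fin powR_ge0.
apply: (le_trans (lee_wpmul2l _ Jr)); first by rewrite lee_fin ltW.
by rewrite -EFinM lee_fin mulrC divfK// gt_eqF.
Qed.

End finite_exponent.

(** * The supremum norm *)

Section supremum_norm.
Variables (R : realType) (d : nat) (m beta : R) (Y : normedModType R[i]).
Hypotheses (m0 : 0 <= m) (beta0 : 0 <= beta).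
Variable f : 'rV[R[i]]_d -> Y.

Lemma fock_norm_infty_ge0 g : (0 <= @fock_norm_infty R d m beta Y g)%E.
Proof.
apply: (@le_trans _ _ (rnorm (g 0) * fock_weight m beta (0 : 'rV[R[i]]_d))%:E).
  by rewrite lee_fin mulr_ge0 ?rnorm_ge0 ?fock_weight_ge0.
by apply: ereal_sup_ubound; exists 0.
Qed.

Lemma fock_infty0_dilation_cvg : fock_infty0 m beta f ->
  fock_norm_infty m beta (f - dilation f r) @[r --> 1^'-] --> 0%E.
Proof.
move=> [ef f_0]; apply/cvge_0P => [r|e e0]; first exact: fock_norm_infty_ge0.
have e20 : 0 < e / 2 by rewrite divr_gt0.
have [M [M0 tail]] : exists M : R, 0 <= M /\ forall z, M < cvec_norm z ->
    rnorm (f z) * fock_weight m beta z < e / 2.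
  have FC : Filter (@cvec_infty R d).
    apply: filter_from_filter; first by exists 0.
    move=> a b _ _; exists (Num.max a b) => // z /=.
    by rewrite gt_max => /andP[].
  have /cvgrPdist_lt/(_ _ e20)[M _ HM] := f_0.
  exists (Num.max 0 M); split; first by rewrite le_max lexx.
  move=> z; rewrite gt_max => /andP[_ /HM].
  by rewrite /= sub0r normrN ger0_norm// mulr_ge0 ?rnorm_ge0 ?fock_weight_ge0.
pose K := [set x : 'rV[R]_(d + d) | forall i, x ord0 i \in `[- (2 * M), 2 * M]].
have cK : compact K.
  apply: (@rV_compact _ _ (fun=> `[- (2 * M), 2 * M]%classic)) => _.
  exact: segment_compact.
have unif := dilation_unif (entire_complex_row_continuous ef) cK e0.
near=> r.
have r1 : r < 1 by near: r; exact: nbhs_left_lt.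
(* Beyond radius 2M, the dilate by r > 1/2 stays beyond radius M. *)
have r2 : 2^-1 < r by near: r; apply: nbhs_left_gt; lra.
have Kr : forall x, K x ->
    rnorm ((f \o @complex_row R d) x - (f \o @complex_row R d) (r *: x)) < e.
  by near: r; exact: cvg_within.
apply: ge_ereal_sup => _ [z _ <-]; rewrite lee_fin.
have [zM|Mz] := leP (cvec_norm z) (2 * M).
  have [x zx] := complex_row_surj z.
  have Kx : K x.
    move=> i; rewrite in_itv/= -ler_norml; apply: le_trans zM.
    by rewrite zx; exact: le_cvec_norm.
  rewrite -[leRHS]mulr1; apply: ler_pM; rewrite ?rnorm_ge0 ?fock_weight_ge0//.
    by have := Kr _ Kx; rewrite /= complex_rowZ -zx => /ltW.
  exact: fock_weight_le1.
have fz : rnorm (f z) * fock_weight m beta z < e / 2.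
  by apply: tail; lra.
have frz : rnorm (f (r%:C%C *: z)) * fock_weight m beta z < e / 2.
  apply: (@le_lt_trans _ _
      (rnorm (f (r%:C%C *: z)) * fock_weight m beta (r%:C%C *: z))).
    apply: ler_wpM2l; first exact: rnorm_ge0.
    by apply: fock_weight_dilation => //; lra.
  by apply: tail; rewrite cvec_normZ; nra.
apply: (@le_trans _ _
    ((rnorm (f z) + rnorm (f (r%:C%C *: z))) * fock_weight m beta z)).
  by apply: ler_wpM2r; [exact: fock_weight_ge0|exact: ler_rnormB].
by rewrite mulrDl; lra.
Unshelve. all: by end_near. Qed.

End supremum_norm.

Theorem proposition7 (R : realType) (d : nat) (m beta p : R)
    (Y : completeNormedModType R[i])
    (hd : (1 <= d)%N) (hm : 1 <= m) (hbeta : 0 < beta) (hp : 1 <= p) :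
  (forall f : 'rV[R[i]]_d -> Y, fock m beta p f ->
     fock_norm m beta p (f - dilation f r) @[r --> 1^'-] --> 0%E) /\
  (forall f : 'rV[R[i]]_d -> Y, fock_infty0 m beta f ->
     fock_norm_infty m beta (f - dilation f r) @[r --> 1^'-] --> 0%E).
Proof.
have m0 : 0 <= m by exact: le_trans hm.
have beta0 : 0 <= beta by exact: ltW.
by split=> f; [exact: fock_dilation_cvg|exact: fock_infty0_dilation_cvg].
Qed.
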